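(* For every positive integer $n$ with $n\equiv 50 \pmod{288}$, there exists a simple planar graph $G$ on $n$ vertices containing neither $K_4$ nor $C_6$ as a subgraph such that $e(G)=\frac{7}{3}(n-2)$.
   Context: $K_4$ is the complete graph on $4$ vertices, $C_6$ the cycle on $6$ vertices; $e(G)$ is the number of edges of $G$. *)

(* Defs.v *)
From HB Require Import structures.
From mathcomp Require Import all_boot all_order all_algebra.
From mathcomp Require Import all_classical all_reals all_analysis.
From mathcomp Require Import Rstruct Rstruct_topology.
Set Implicit Arguments. Unset Strict Implicit. Unset Printing Implicit Defensive.
Import Order.TTheory GRing.Theory Num.Theory.

Definition simple_graph (V : finType) (e : rel V) : Prop :=
  symmetric e /\ irreflexive e.

Definition edges (V : finType) (e : rel V) : {set {set V}} :=
  [set A : {set V} | [exists x : V, exists y : V, e x y && (A == [set x; y])]]%SET.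

Definition contains_subgraph (k : nat) (H : rel 'I_k) (V : finType) (e : rel V) : Prop :=
  exists f : 'I_k -> V, injective f /\ forall i j, H i j -> e (f i) (f j).

Definition K4 : rel 'I_4 := fun i j => i != j.
Definition C6 : rel 'I_6 := fun i j =>
  (val j == (val i).+1 %% 6) || (val i == (val j).+1 %% 6).

Local Open Scope ring_scope.

Definition plane_embedding (V : finType) (e : rel V)
    (p : V -> Rdefinitions.R * Rdefinitions.R) (arc : V -> V -> Rdefinitions.R -> Rdefinitions.R * Rdefinitions.R) : Prop :=
  injective p /\
  (forall x y, e x y ->
     {within `[0, 1], continuous (arc x y)}%classic /\
     arc x y 0 = p x /\ arc x y 1 = p y /\
     (forall s t : Rdefinitions.R, 0 <= s <= 1 -> 0 <= t <= 1 -> arc x y s = arc x y t -> s = t) /\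
     (forall (t : Rdefinitions.R) (z : V), 0 < t < 1 -> arc x y t <> p z)) /\
  (forall x y u v, e x y -> e u v -> ([set x; y] != [set u; v] :> {set V})%SET ->
     forall s t : Rdefinitions.R, 0 < s < 1 -> 0 < t < 1 -> arc x y s <> arc u v t).

Definition planar (V : finType) (e : rel V) : Prop :=
  exists p arc, plane_embedding e p arc.

(* Main.v *)
Require Import Defs.
From mathcomp Require Import all_boot all_order all_algebra.
From mathcomp Require Import all_classical all_reals all_analysis.
From mathcomp Require Import Rstruct Rstruct_topology.
From mathcomp Require Import ssrZ zify.
From Stdlib Require Import ZArith.
From mathcomp Require Import ring lra.
Set Implicit Arguments. Unset Strict Implicit. Unset Printing Implicit Defensive.
Import Order.TTheory GRing.Theory Num.Theory.
Import numFieldNormedType.Exports.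

(** Take a plane map with only quadrilaterals and heptagons as faces, each edge
    separating a quadrilateral from a heptagon, and put a hub into every
    quadrilateral. The result is a union of edge-disjoint wheels with four spokes
    whose faces are triangles and heptagons. If there are q wheels and h heptagons,
    then e = 8 q and 4 q = 7 h, so Euler's formula reads 3 e = 7 (n - 2).
    A 6-cycle cannot live in one wheel, and the wheels can be arranged so that a
    cycle through several of them has length at least 7.

    The maps used here are tubes: a bottom cap with 27 vertices, m layers with 24
    vertices each, and a top cap with 23 vertices; every cap and layer consists
    of seven wheels. They are drawn with straight edges as nested rings, each layer
    being the previous one dilated by 4. Hence the tube with m + 1 layers agrees
    with the tube with m layers away from the top, and also, after a shift of the
    labels by 24 and a dilation by 4, away from the bottom. A 6-cycle, or a pair
    of nearby edges, misses one of the ends of a long tube, so all local statements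
    reduce to m <= 5, where they are computed. Two edges near different ends are
    separated by a linear functional that is positive on the outer one, and such a
    functional survives dilating the outer edge alone. *)

(** * The graphs *)

(* Vertices are numbered from the centre of the tube outwards: 0 to 26 form the
   bottom cap, the next [24 * m] the layers, the last 23 the top cap. Entry [i] of
   a table below lists the [d] such that vertex number [i] of the corresponding
   part is joined to the vertex whose label is smaller by [d]; the last four
   vertices of each part but the top are shared with the wheels of the next part. *)
Definition bottom_offsets : seq (seq nat) :=
  [:: [::]; [::]; [::]; [::]; [::]; [::]; [::]; [:: 6; 7]; [:: 6; 7];
      [:: 1; 6; 7]; [:: 1; 6; 7]; [:: 1; 6; 7]; [:: 5; 7; 12];
      [:: 5; 7; 11]; [:: 2; 3; 8; 9]; [:: 8; 15]; [:: 8; 9; 15];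
      [:: 4; 8; 15]; [:: 8; 15]; [:: 9; 15]; [:: 8; 9; 15]; [:: 7; 8; 15];
      [:: 8; 9; 16]; [:: 8; 11; 23]; [:: 16; 17; 23]; [:: 7; 16; 22];
      [:: 7; 15; 22]].

Definition layer_offsets : seq (seq nat) :=
  [:: [:: 4]; [::]; [:: 5]; [::]; [:: 6]; [::]; [:: 7]; [:: 6; 7; 11];
      [:: 1; 6; 7]; [:: 1; 6; 7; 12]; [:: 6; 7; 12]; [:: 6; 7; 13];
      [:: 1; 6; 7; 13]; [:: 1; 7; 13; 17]; [:: 7; 13]; [:: 7; 13; 18];
      [:: 6; 7; 13]; [:: 6; 7; 13]; [:: 6; 13]; [:: 6; 13; 20];
      [:: 7; 13; 20]; [:: 7; 13; 20]; [:: 12; 13; 19]; [:: 5; 12; 18]].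

Definition top_offsets : seq (seq nat) :=
  [:: [:: 4]; [:: 2]; [::]; [:: 5]; [:: 7]; [::]; [::]; [:: 6; 7; 8];
      [:: 6; 7; 9]; [:: 1; 6; 7; 11]; [:: 1; 6; 7]; [:: 1; 6; 7; 14];
      [:: 5; 7; 12; 16]; [:: 5; 7; 11]; [:: 2; 3; 8; 9]; [:: 8; 15; 19];
      [:: 8; 9; 15]; [:: 4; 8; 15]; [:: 8; 15; 20]; [:: 9; 15; 22];
      [:: 8; 9; 15]; [:: 7; 8; 15]; [:: 8; 9; 16]].

(* Coordinates before dilation: [point] multiplies those of part [j], counted from
   0 at the bottom, by [4 ^ j]. They were found by numerical optimisation of the
   angles in a drawing and then rounded. *)
Definition bottom_points : seq (Z * Z) :=
  [:: (37, -32); (-5, -33); (-20, -5); (-33, 14); (12, 40); (26, 6);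
      (-1, 0); (12, -35); (-24, -27); (-30, -1); (-10, 29); (34, 26);
      (43, -15); (-8, -3); (7, 2); (45, -45); (-6, -25); (-13, 0);
      (-42, 27); (-2, 47); (35, 11); (-2, -4); (-2, 4); (73, -32);
      (-10, -78); (-72, 2); (18, 82)]%Z.

Definition layer_points : seq (Z * Z) :=
  [:: (33, -18); (7, -56); (-11, -32); (-50, 0); (-30, 14); (11, 46);
      (11, 21); (32, -34); (-9, -47); (-39, -24); (-48, 11); (-25, 33);
      (5, 32); (25, 20); (22, -60); (-2, -27); (-37, -12); (-33, 24);
      (24, 48); (14, 16); (73, -32); (-10, -78); (-72, 2); (18, 82)]%Z.

Definition top_points : seq (Z * Z) :=
  [:: (29, -2); (2, 39); (-46, -1); (-21, -6); (-8, -23); (16, -45);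
      (-53, -86); (40, 18); (-42, 40); (-30, -1); (-20, -18); (-7, -35);
      (47, -27); (-87, -21); (16, -87); (23, 3); (1, 81); (-42, -18);
      (-17, -10); (-10, -18); (14, -32); (-91, -148); (-36, -65)]%Z.

Definition table {T : Type} (x0 : T) (bottom layer top : seq T) (m v : nat) : T :=
  if v < 27 then nth x0 bottom v
  else if v < 27 + 24 * m then nth x0 layer ((v - 27) %% 24)
  else nth x0 top (v - (27 + 24 * m)).

Definition offsets : nat -> nat -> seq nat :=
  table [::] bottom_offsets layer_offsets top_offsets.

Definition back (m x y : nat) : bool := (x < y) && (y - x \in offsets m y).

Definition adj (m x y : nat) : bool := back m x y || back m y x.

(* By truncated subtraction all 27 labels of the bottom cap get the exponent 0. *)
Definition point (m v : nat) : Z * Z :=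
  let p := table (0, 0)%Z bottom_points layer_points top_points m v in
  let s := (4 ^ Z.of_nat ((v - 3) %/ 24))%Z in (s * p.1, s * p.2)%Z.

Lemma table_low T (x0 : T) b l t m v :
  v < 27 + 24 * m -> table x0 b l t m.+1 v = table x0 b l t m v.
Proof. by rewrite /table => h; case: (v < 27); rewrite // h ifT //; lia. Qed.

(** The bound 51 is 27 + 24: such a [v] lies beyond the bottom cap and the first layer, so that
    [v - 24] is still outside the bottom cap. *)
Lemma table_shift T (x0 : T) b l t m v :
  51 <= v -> table x0 b l t m.+1 v = table x0 b l t m (v - 24).
Proof.
rewrite /table => h; have -> : (v < 27) = false by lia.
have -> : (v - 24 < 27) = false by lia.
have -> : (v - 24 < 27 + 24 * m) = (v < 27 + 24 * m.+1) by lia.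
have -> : (v - 27) %% 24 = (v - 24 - 27) %% 24 by lia.
by have -> : v - 24 - (27 + 24 * m) = v - (27 + 24 * m.+1) by lia.
Qed.

Lemma table_all T (x0 : T) (P : pred T) b l t m v :
  P x0 -> all P (b ++ l ++ t) -> P (table x0 b l t m v).
Proof.
rewrite !all_cat => P0 /and3P[Pb Pl Pt].
have nthP s i : all P s -> P (nth x0 s i).
  move=> sP; case: (ltnP i (size s)) => h; last by rewrite nth_default.
  exact: all_nthP.
by rewrite /table; do 2?case: ifP => _; apply: nthP.
Qed.

Lemma offsets_bound m v d : d \in offsets m v -> 0 < d <= 23.
Proof.
by apply: (allP (table_all (P := all (fun d => 0 < d <= 23)) m v _ _)).
Qed.

Lemma offsets_le m v d : d \in offsets m v -> d <= v.
Proof.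
case: (ltnP v 27) => h; last by move/offsets_bound; lia.
rewrite /offsets /table h => dv.
have: all (fun v => all (leq^~ v) (nth [::] bottom_offsets v)) (iota 0 27) by [].
by move/allP/(_ v); rewrite mem_iota => /(_ h)/allP; exact.
Qed.

Lemma offsets_uniq m v : uniq (offsets m v).
Proof. exact: table_all. Qed.

Lemma offsets_oversize m v : 50 + 24 * m <= v -> offsets m v = [::].
Proof.
rewrite /offsets /table => h; do 2 (rewrite ifF; last lia).
by rewrite nth_default //=; lia.
Qed.

Lemma back_bound m x y : back m x y -> x < y <= x + 23.
Proof. by case/andP=> -> /offsets_bound; lia. Qed.

Lemma back_size m x y : back m x y -> y < 50 + 24 * m.
Proof. by case/andP=> _; case: ltnP => // /offsets_oversize ->. Qed.

Lemma adjC m : symmetric (adj m).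
Proof. by move=> x y; rewrite /adj orbC. Qed.

Lemma adjxx m : irreflexive (adj m).
Proof. by move=> x; rewrite /adj /back ltnn. Qed.

Lemma adj_bound m x y : adj m x y -> (x <= y + 23) && (y <= x + 23).
Proof. by case/orP=> /back_bound; lia. Qed.

Lemma adj_size m x y : adj m x y -> x < 50 + 24 * m.
Proof. by case/orP=> h; have := back_size h; have := back_bound h; lia. Qed.

Lemma back_low m x y : y < 27 + 24 * m -> back m.+1 x y = back m x y.
Proof. by rewrite /back /offsets => h; rewrite table_low. Qed.

Lemma back_shift m x y :
  51 <= x -> 51 <= y -> back m.+1 x y = back m (x - 24) (y - 24).
Proof.
rewrite /back /offsets => hx hy; rewrite table_shift //.
have -> : (x - 24 < y - 24) = (x < y) by lia.
by have -> : y - 24 - (x - 24) = y - x by lia.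
Qed.

Lemma adj_low m x y :
  x < 27 + 24 * m -> y < 27 + 24 * m -> adj m.+1 x y = adj m x y.
Proof. by move=> hx hy; rewrite /adj !back_low. Qed.

Lemma adj_shift m x y :
  51 <= x -> 51 <= y -> adj m.+1 x y = adj m (x - 24) (y - 24).
Proof. by move=> hx hy; rewrite /adj !back_shift. Qed.

Definition neighbours (m v : nat) : seq nat :=
  [seq w <- iota (v - 23) 47 | adj m v w].

Lemma mem_neighbours m v w : (w \in neighbours m v) = adj m v w.
Proof.
rewrite mem_filter mem_iota; case h : adj => //=.
by have := adj_bound h; lia.
Qed.

(** Computed once per tube, so that the exhaustive searches only look neighbours up. *)
Definition neighbour_table (m : nat) : seq (seq nat) :=
  mkseq (neighbours m) (50 + 24 * m).

Lemma mem_neighbour_table m v w :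
  (w \in nth [::] (neighbour_table m) v) = adj m v w.
Proof.
case: (ltnP v (50 + 24 * m)) => h; first by rewrite nth_mkseq // mem_neighbours.
rewrite nth_default ?size_mkseq //; apply/esym/negbTE/negP => /adj_size.
by rewrite ltnNge h.
Qed.

(* The bound 69 = 3 * 23 is the largest difference of labels along a 6-cycle. *)
Definition embeds (k : nat) (H : rel 'I_k) (m : nat) : Prop :=
  exists f : 'I_k -> nat, [/\ injective f, forall i j, H i j -> adj m (f i) (f j)
    & forall i j, f i <= f j + 69].

(** If some label is at least 27 + 24 * m >= 123, the window of width 69 puts all labels at 54 or
    more, and the whole image shifts down by one layer. Otherwise it lies where both tubes agree. *)
Lemma embeds_pred k (H : rel 'I_k) m : 4 <= m -> embeds H m.+1 -> embeds H m.
Proof.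
move=> m4 [f [fI fH fw]].
have [/forallP low|/forallPn[i hi]] := boolP [forall i, f i < 27 + 24 * m].
  by exists f; split=> // i j /fH; rewrite adj_low.
have high j : 51 <= f j by have := fw i j; lia.
exists (fun i => f i - 24); split=> [j j'|j j' /fH|j j'].
- by move=> e; apply: fI; have := high j; have := high j'; lia.
- by rewrite adj_shift.
- by have := fw j j'; lia.
Qed.

Lemma embeds_small k (H : rel 'I_k) m :
  embeds H m -> exists2 m', m' < 5 & embeds H m'.
Proof.
elim: m => [|m IH] Hm; first by exists 0.
case: (ltnP m 4) => h; first by exists m.+1.
exact/IH/embeds_pred.
Qed.

(** Symmetry is broken by taking [a] as the largest label. *)
Definition K4_free_at (m : nat) : bool :=
  let tab := neighbour_table m in let nb := nth [::] tab in
  all (fun a => let ab := [seq b <- nb a | b < a] in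
    all (fun b => all (fun c => all (fun d =>
      [|| c \notin nb b, d \notin nb b | d \notin nb c]) ab) ab) ab)
  (iota 0 (50 + 24 * m)).

(** The cycle is [a b c d e f], again with [a] largest. Consecutive vertices differ by irreflexivity
    of [adj], so only the remaining pairs are compared. *)
Definition C6_free_at (m : nat) : bool :=
  let tab := neighbour_table m in let nb := nth [::] tab in
  all (fun a => let ab := [seq b <- nb a | b < a] in
    all (fun b => all (fun c => all (fun d => all (fun e => all (fun f =>
      (f \in [:: b; c; d]) || (f \notin nb e)) ab)
      [seq e <- nb d | (e < a) && (e \notin [:: b; c])])
      [seq d <- nb c | (d < a) && (d != b)])
      [seq c <- nb b | c < a]) ab)
  (iota 0 (50 + 24 * m)).

Lemma K4_free_small : all K4_free_at (iota 0 5).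
Proof. by vm_compute. Qed.

Lemma C6_free_small : all C6_free_at (iota 0 5).
Proof. by vm_compute. Qed.

Lemma K4_free_smallP m a b c d : m < 5 -> b < a -> c < a -> d < a ->
  adj m a b -> adj m a c -> adj m a d -> adj m b c -> adj m b d -> ~~ adj m c d.
Proof.
move=> m5 ba ca da ab ac ad bc bd.
have : K4_free_at m by apply: (allP K4_free_small); rewrite mem_iota.
rewrite /K4_free_at; cbv zeta => /allP/(_ a).
rewrite mem_iota (adj_size ab) => /(_ isT).
move/allP/(_ b); rewrite mem_filter mem_neighbour_table ba ab => /(_ isT).
move/allP/(_ c); rewrite mem_filter mem_neighbour_table ca ac => /(_ isT).
move/allP/(_ d); rewrite mem_filter mem_neighbour_table da ad => /(_ isT).
by rewrite !mem_neighbour_table bc bd.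
Qed.

Lemma C6_free_smallP m a b c d e f : m < 5 ->
  uniq [:: b; c; d; e; f] -> all (fun x => x < a) [:: b; c; d; e; f] ->
  adj m a b -> adj m b c -> adj m c d -> adj m d e -> adj m e f -> ~~ adj m a f.
Proof.
move=> m5 u /and5P[ba ca da ea /andP[fa _]] ab bc cd de ef; apply/negP => af.
have : C6_free_at m by apply: (allP C6_free_small); rewrite mem_iota.
rewrite /C6_free_at; cbv zeta => /allP/(_ a).
rewrite mem_iota (adj_size ab) => /(_ isT).
move/allP/(_ b); rewrite mem_filter mem_neighbour_table ba ab => /(_ isT).
move/allP/(_ c); rewrite mem_filter mem_neighbour_table ca bc => /(_ isT).
move: u; rewrite /= !inE !negb_or -!andbA.
case/and5P=> nbc nbd nbe nbf /and5P[ncd nce ncf nde /and3P[ndf nef _]].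
move/allP/(_ d); rewrite mem_filter mem_neighbour_table da eq_sym nbd cd => /(_ isT).
move/allP/(_ e); rewrite mem_filter mem_neighbour_table ea !inE negb_or.
rewrite eq_sym nbe eq_sym nce de => /(_ isT).
move/allP/(_ f); rewrite mem_filter mem_neighbour_table fa af => /(_ isT).
rewrite mem_neighbour_table ef orbF !inE.
by rewrite eq_sym (negbTE nbf) eq_sym (negbTE ncf) eq_sym (negbTE ndf).
Qed.

(** Serves to keep vertices off foreign edges: an edge at the vertex is the witness there. In all
    three tables, a vertex with an empty row is joined to the one whose label is larger by 7. *)
Lemma exists_adj m v : v < 50 + 24 * m -> exists w, adj m v w.
Proof.
have back_ex d : d \in offsets m v -> exists w, adj m v w.
  move=> dv; exists (v - d); apply/orP; right.
  have := offsets_bound dv; have := offsets_le dv => *.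
  by apply/andP; split; [lia | have -> : v - (v - d) = d by lia].
have forth_ex : 7 \in offsets m (v + 7) -> exists w, adj m v w.
  move=> dv; exists (v + 7); apply/orP; left.
  by rewrite /back addKn dv andbT; lia.
have some (s : seq nat) : ~~ nilp s -> exists d, d \in s.
  by case: s => // d s _; exists d; rewrite mem_head.
move=> hv; have [low|] := ltnP v 27.
  have: all (fun v => ~~ nilp (nth [::] bottom_offsets v) ||
      (v + 7 < 27) && (7 \in nth [::] bottom_offsets (v + 7))) (iota 0 27) by [].
  move/allP/(_ v); rewrite mem_iota => /(_ low)/orP[/some[d]|/andP[low' h]].
    by move=> h; apply: (back_ex d); rewrite /offsets /table low.
  by apply: forth_ex; rewrite /offsets /table low'.
move=> v27; have [mid|high] := ltnP v (27 + 24 * m).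
  have: all (fun r => ~~ nilp (nth [::] layer_offsets r) ||
      (r < 17) && (7 \in nth [::] layer_offsets (r + 7))) (iota 0 24) by [].
  move/allP/(_ ((v - 27) %% 24)); rewrite mem_iota ltn_mod => /(_ isT).
  case/orP=> [/some[d]|/andP[r17 h]].
    move=> h; apply: (back_ex d); rewrite /offsets /table.
    by rewrite ifF ?mid //; lia.
  apply: forth_ex; rewrite /offsets /table ifF ?ifT; try lia.
  by have -> : (v + 7 - 27) %% 24 = (v - 27) %% 24 + 7 by lia.
have: all (fun r => ~~ nilp (nth [::] top_offsets r) ||
    (7 \in nth [::] top_offsets (r + 7))) (iota 0 23) by [].
move/allP/(_ (v - (27 + 24 * m))); rewrite mem_iota.
have -> : v - (27 + 24 * m) < 0 + 23 by lia.
move=> /(_ isT)/orP[/some[d]|] h.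
  apply: (back_ex d); rewrite /offsets /table.
  by rewrite ifF ?ifF //; lia.
apply: forth_ex; rewrite /offsets /table; do 2 (rewrite ifF; last lia).
by have -> : v + 7 - (27 + 24 * m) = v - (27 + 24 * m) + 7 by lia.
Qed.

Lemma sum_offsets m :
  \sum_(0 <= y < 50 + 24 * m) size (offsets m y) = 112 + 56 * m.
Proof.
elim: m => [|m IH]; first by rewrite unlock.
rewrite (@big_cat_nat _ _ _ 51) /=; try lia.
(* The bottom cap and the first layer, with 56 edges each counted at their larger ends; the
   one-layer tube has the same offsets there and allows computation. *)
have -> : \sum_(0 <= y < 51) size (offsets m.+1 y) = 56 + 56.
  rewrite (eq_big_nat _ _ (F2 := fun y => size (offsets 1 y))).
    by rewrite unlock.
  move=> y /andP[_ h]; rewrite /offsets /table; case: ifP => // _.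
  by rewrite ifT ?ifT //; lia.
have -> : \sum_(51 <= y < 50 + 24 * m.+1) size (offsets m.+1 y) =
          \sum_(27 <= y < 50 + 24 * m) size (offsets m y).
  have -> : 50 + 24 * m.+1 = 50 + 24 * m + 24 by lia.
  rewrite (big_addn 27 _ 24); have -> : 50 + 24 * m + 24 - 24 = 50 + 24 * m by lia.
  apply: eq_big_nat => y /andP[h _]; rewrite /offsets table_shift ?addnK //.
  by rewrite (leq_add2r 24 27).
move: IH; rewrite (@big_cat_nat _ _ _ 27) /=; try lia.
suff -> : \sum_(0 <= y < 27) size (offsets m y) = 56 by lia.
rewrite (eq_big_nat _ _ (F2 := fun y => size (offsets 0 y))).
  by rewrite unlock.
by move=> y /andP[_ h]; rewrite /offsets /table h.
Qed.

(** * Forbidden subgraphs and the number of edges *)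

Lemma K4_not_embeds m : ~ embeds K4 m.
Proof.
case/embeds_small=> {}m m5 [f [fI fH _]].
have [i0 _ maxf] := arg_maxnP (fun i : 'I_4 => f i) (isT : predT ord0).
have ltf i : i != i0 -> f i < f i0.
  move=> ii0; rewrite ltn_neqAle (eqtype.inj_eq fI) ii0.
  exact: (maxf i isT).
(* Indices are rotated so that the largest label comes first, as the search expects. *)
pose s k : 'I_4 := inord ((i0 + k) %% 4).
have sE k : s k = (i0 + k) %% 4 :> nat by rewrite inordK // ltn_mod.
have neq j k : j < 4 -> k < 4 -> j != k -> s j != s k.
  by move=> j4 k4 jk; rewrite -val_eqE /= !sE; have := ltn_ord i0; lia.
have s0 : s 0 = i0 by apply/val_inj; rewrite /= sE; have := ltn_ord i0; lia.
have lts k : 0 < k < 4 -> f (s k) < f (s 0).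
  by move=> h; rewrite s0; apply: ltf; rewrite -s0; apply: neq; lia.
have := @K4_free_smallP m (f (s 0)) (f (s 1)) (f (s 2)) (f (s 3)) m5.
rewrite !lts // => /(_ isT isT isT); rewrite !fH; try exact: neq.
by move=> /(_ isT isT isT isT isT).
Qed.

Lemma C6_not_embeds m : ~ embeds C6 m.
Proof.
case/embeds_small=> {}m m5 [f [fI fH _]].
have [i0 _ maxf] := arg_maxnP (fun i : 'I_6 => f i) (isT : predT ord0).
have ltf i : i != i0 -> f i < f i0.
  move=> ii0; rewrite ltn_neqAle (eqtype.inj_eq fI) ii0.
  exact: (maxf i isT).
(* Rotation keeps the cyclic order, so this walks around the same cycle from its largest label. *)
pose s k : 'I_6 := inord ((i0 + k) %% 6).
have sE k : s k = (i0 + k) %% 6 :> nat by rewrite inordK // ltn_mod.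
have neq j k : j < 6 -> k < 6 -> j != k -> s j != s k.
  by move=> j6 k6 jk; rewrite -val_eqE /= !sE; have := ltn_ord i0; lia.
have s0 : s 0 = i0 by apply/val_inj; rewrite /= sE; have := ltn_ord i0; lia.
have lts k : 0 < k < 6 -> f (s k) < f (s 0).
  by move=> h; rewrite s0; apply: ltf; rewrite -s0; apply: neq; lia.
have adjs k : adj m (f (s k)) (f (s k.+1)).
  by apply: fH; rewrite /C6 /= !sE; lia.
have s6 : s 6 = s 0 by apply/val_inj; rewrite /= !sE; lia.
have := @C6_free_smallP m (f (s 0)) (f (s 1)) (f (s 2)) (f (s 3)) (f (s 4))
  (f (s 5)) m5.
rewrite !adjs [adj m (f (s 0)) (f (s 5))]adjC -s6 adjs s6 /= !lts //.
rewrite !inE !negb_or !(eqtype.inj_eq fI) !neq //.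
by move=> /(_ isT isT isT isT isT isT isT).
Qed.

Lemma embeds_of_subgraph k (H : rel 'I_k) m n (e : rel 'I_n) :
  (forall x y : 'I_n, e x y = adj m x y) ->
  (forall f : 'I_k -> nat, (forall i j, H i j -> adj m (f i) (f j)) ->
    forall i j, f i <= f j + 69) ->
  contains_subgraph H e -> embeds H m.
Proof.
move=> eE win [f [fI fH]].
have fH' i j : H i j -> adj m (f i) (f j) by rewrite -eE; apply: fH.
exists (fun i => f i : nat); split=> //; last exact: (win (fun i => f i : nat)).
by move=> i j /val_inj/fI.
Qed.

Lemma K4_window m (f : 'I_4 -> nat) :
  (forall i j, K4 i j -> adj m (f i) (f j)) -> forall i j, f i <= f j + 69.
Proof.
move=> fH i j; have [->|ij] := eqVneq i j; first by rewrite leq_addr.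
by have := adj_bound (fH i j ij); lia.
Qed.

Lemma C6_window m (f : 'I_6 -> nat) :
  (forall i j, C6 i j -> adj m (f i) (f j)) -> forall i j, f i <= f j + 69.
Proof.
move=> fH i j; pose s k : 'I_6 := inord (k %% 6).
have sE k : s k = k %% 6 :> nat by rewrite inordK // ltn_mod.
have adjs k : (f (s k) <= f (s k.+1) + 23) && (f (s k.+1) <= f (s k) + 23).
  by apply: (@adj_bound m); apply: fH; rewrite /C6 /= !sE; lia.
have s6 : s 6 = s 0 by apply/val_inj; rewrite /= !sE.
have sord (k : 'I_6) : k = s k by apply/val_inj; rewrite /= sE modn_small.
have := adjs 0; have := adjs 1; have := adjs 2; have := adjs 3.
have := adjs 4; have := adjs 5; rewrite s6 (sord i) (sord j).
by case: i j => [[|[|[|[|[|[|i]]]]]] ?] [[|[|[|[|[|[|j]]]]]] ?] //=; lia.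
Qed.

(** Every edge is counted at its larger end, where it matches exactly one entry of the offset
    list. *)
Lemma card_edges m (e : rel 'I_(50 + 24 * m)) :
  (forall x y, e x y = adj m x y) -> #|edges e| = 112 + 56 * m.
Proof.
move=> eE; set n := 50 + 24 * m in e eE *.
pose B : {set 'I_n * 'I_n} := [set q : 'I_n * 'I_n | back m q.1 q.2].
have -> : edges e = [set [set q.1; q.2] | q : 'I_n * 'I_n in B].
  apply/setP => A; rewrite inE; apply/existsP/imsetP.
    case=> x /existsP[y /andP[]]; rewrite eE => /orP[] xy /eqP ->.
      by exists (x, y); rewrite ?inE.
    by exists (y, x); rewrite ?inE // finset.setUC.
  case=> -[x y]; rewrite inE /= => xy ->; exists x; apply/existsP; exists y.
  by rewrite eE /adj xy eqxx.
rewrite card_in_imset; last first.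
  move=> [x y] [u v]; rewrite !inE /= => xy uv /setP eq2.
  have := back_bound xy; have := back_bound uv.
  have := eq2 x; have := eq2 y; have := eq2 u; rewrite !inE !eqxx ?orbT /=.
  rewrite -!val_eqE /= => h1 h2 h3 h4 h5.
  by congr pair; apply/val_inj => /=; lia.
rewrite -sum_offsets big_mkord -sum1_card.
rewrite (eq_bigl (fun q : 'I_n * 'I_n => true && back m q.1 q.2)); last first.
  by move=> q; rewrite inE.
rewrite -(pair_big_dep xpredT (fun x y : 'I_n => back m x y) (fun _ _ => 1)) /=.
rewrite (exchange_big_dep xpredT) //=; apply: eq_bigr => y _.
have oK d : d \in offsets m y -> y - d < n.
  by move=> _; have := ltn_ord y; lia.
pose s : seq 'I_n := pmap insub [seq y - d | d <- offsets m y].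
have mem_s x : (x \in s) = back m x y.
  rewrite mem_pmap_sub; apply/mapP/andP => [[d dy ->]|[xy dy]].
    have := offsets_bound dy; have := offsets_le dy => *.
    by split; [lia | have -> : y - (y - d) = d by lia].
  by exists (y - x) => //; rewrite /=; lia.
have us : uniq s.
  apply/pmap_sub_uniq; rewrite map_inj_in_uniq ?offsets_uniq // => d d'.
  by move=> /offsets_le ? /offsets_le ? ?; lia.
rewrite sum1_card -(eq_card (A := mem s)) //.
rewrite (card_uniqP us) size_pmap_sub; have /allP h := oK.
by rewrite -[RHS](size_map (fun d => y - d)); apply/eqP; rewrite -all_count all_map.
Qed.

(** * Separation of edges over the integers *)

Definition scale (s : Z) (p : Z * Z) : Z * Z := (s * p.1, s * p.2)%Z.

Lemma point_low m v : v < 27 + 24 * m -> point m.+1 v = point m v.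
Proof. by move=> h; rewrite /point table_low. Qed.

Lemma point_shift m v : 51 <= v -> point m.+1 v = scale 4 (point m (v - 24)).
Proof.
move=> h; rewrite /point table_shift // /scale.
have -> : (v - 3) %/ 24 = ((v - 24 - 3) %/ 24).+1 by lia.
rewrite Nat2Z.inj_succ Z.pow_succ_r; last exact: Zle_0_nat.
by congr pair; apply/esym/Z.mul_assoc.
Qed.

Definition dot (a p : Z * Z) : Z := (a.1 * p.1 + a.2 * p.2)%Z.

Definition cross (o p q : Z * Z) : Z :=
  ((p.1 - o.1) * (q.2 - o.2) - (p.2 - o.2) * (q.1 - o.1))%Z.

Definition separates (a p q u v : Z * Z) : bool :=
  let dp := dot a p in let dq := dot a q in
  let du := dot a u in let dv := dot a v in
  [&& dp <? du, dp <? dv, dq <? du & dq <? dv]%Z.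

Definition separated (p q u v : Z * Z) : Prop :=
  exists a, separates a p q u v.

(* Positivity on the second segment makes this stable under dilating it alone. *)
Definition far_separated (p q u v : Z * Z) : Prop :=
  exists a, [&& separates a p q u v, 0 <? dot a u & 0 <? dot a v]%Z.

Lemma dot_scale a s p : dot a (scale s p) = (s * dot a p)%Z.
Proof. by rewrite /dot /scale /=; ring. Qed.

Lemma separated_scale p q u v : separated p q u v ->
  separated (scale 4 p) (scale 4 q) (scale 4 u) (scale 4 v).
Proof. by case=> a h; exists a; move: h; rewrite /separates !dot_scale; lia. Qed.

Lemma far_separated_scale p q u v : far_separated p q u v ->
  far_separated (scale 4 p) (scale 4 q) (scale 4 u) (scale 4 v).
Proof. by case=> a h; exists a; move: h; rewrite /separates !dot_scale; lia. Qed.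

Lemma far_separated_away p q u v : far_separated p q u v ->
  far_separated p q (scale 4 u) (scale 4 v).
Proof. by case=> a h; exists a; move: h; rewrite /separates !dot_scale; lia. Qed.

Lemma far_separatedW p q u v : far_separated p q u v -> separated p q u v.
Proof. by case=> a /andP[h _]; exists a. Qed.

Lemma separatedC p q u v : separated p q u v -> separated u v p q.
Proof.
case=> -[a b]; rewrite /separates /dot /= => h.
by exists (- a, - b)%Z; rewrite /separates /dot /=; lia.
Qed.

(* The flag tells whether [p] and [q] are the same vertex. *)
Definition transverse (same : bool) (o p q : Z * Z) : bool :=
  if same then o != p else cross o p q != 0%Z.

Lemma transverse_scale b o p q :
  transverse b o p q -> transverse b (scale 4 o) (scale 4 p) (scale 4 q).
Proof.
case: o p q => [a1 a2] [p1 p2] [q1 q2]; rewrite /transverse; case: b.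
  apply: contra_neq => h; have h1 : (4 * a1 = 4 * p1)%Z := congr1 fst h.
  by have h2 : (4 * a2 = 4 * p2)%Z := congr1 snd h; congr pair; lia.
have e : (cross (scale 4 (a1, a2)) (scale 4 (p1, p2)) (scale 4 (q1, q2)) =
          16 * cross (a1, a2) (p1, p2) (q1, q2))%Z.
  by rewrite /cross /scale /fst /snd; ring.
by apply: contra_neq; rewrite e; lia.
Qed.

Definition edge_list (m : nat) : seq (nat * nat) :=
  [seq (y - d, y) | y <- iota 0 (50 + 24 * m), d <- offsets m y].

Lemma mem_edge_list m x y : back m x y -> (x, y) \in edge_list m.
Proof.
move=> xy; have := back_size xy; case/andP: xy => xy hd hy.
have -> : (x, y) = (y - (y - x), y) by congr pair; lia.
by apply/(allpairs_f_dep (fun y d => (y - d, y))) => //; rewrite mem_iota.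
Qed.

Definition left_normal (p q : Z * Z) : Z * Z := (p.2 - q.2, q.1 - p.1)%Z.

(** For distant edges the sum of the two outer endpoints is tried as functional. For near ones the
    candidates are the normals: the difference set of two non-parallel segments is a parallelogram
    with sides parallel to them, so if it misses 0, one of these normals separates. *)
Definition separation_test (x y u v : nat) (p q r s : Z * Z) : bool :=
  if y + 24 <= u then
    let a := (r.1 + s.1, r.2 + s.2)%Z in
    [&& separates a p q r s, 0 <? dot a r & 0 <? dot a s]%Z
  else has (fun a => separates a p q r s)
    [:: left_normal p q; left_normal q p; left_normal r s; left_normal s r].

(** The bounds keep the pairs that the induction cannot reduce: the outer edge ends in the last
    layer or the top cap, at label 24 * m + 3 or later, and one edge starts below 51, so the inner
    one starts below 74 = 51 + 23. *)
Definition separated_at (m : nat) : bool :=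
  let es := [seq (e, (point m e.1, point m e.2)) | e <- edge_list m] in
  let low := [seq e <- es | e.1.1 < 74] in
  let high := [seq e <- es | 24 * m <= e.1.2] in
  all (fun f => all (fun e => [|| f.1.2 < e.1.2, e.1.2 == f.1.2, e.1.2 == f.1.1,
        e.1.1 == f.1.1
      | separation_test e.1.1 e.1.2 f.1.1 f.1.2 e.2.1 e.2.2 f.2.1 f.2.2]) low) high.

Lemma separated_small : all separated_at (iota 0 6).
Proof. by vm_compute. Qed.

Definition transverse_at (m : nat) : bool :=
  all (fun x =>
    let nb := [seq (y, point m y) | y <- neighbours m x] in let o := point m x in
    all (fun q => all (fun r => transverse (q.1 == r.1) o q.2 r.2) nb) nb)
    (iota 0 (50 + 24 * m)).

Lemma transverse_small : all transverse_at (iota 0 5).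
Proof. by vm_compute. Qed.

Lemma transverse_smallP m x y v : m < 5 -> adj m x y -> adj m x v ->
  transverse (y == v) (point m x) (point m y) (point m v).
Proof.
move=> m5 xy xv.
have : transverse_at m by apply: (allP transverse_small); rewrite mem_iota.
rewrite /transverse_at => /allP/(_ x).
rewrite mem_iota (adj_size xy) => /(_ isT); cbv zeta.
move=> /allP/(_ (y, point m y)); rewrite map_f ?mem_neighbours //.
move=> /(_ isT) /allP/(_ (v, point m v)); rewrite map_f ?mem_neighbours //.
exact.
Qed.

Lemma edges_separated_small m x y u v : m < 6 ->
  back m x y -> back m u v -> y <= v -> y != v -> y != u -> x != u ->
  x < 74 -> 24 * m <= v ->
  separation_test x y u v (point m x) (point m y) (point m u) (point m v).
Proof.
move=> m6 /mem_edge_list xy /mem_edge_list uv yv nyv nyu nxu xlow hv.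
have : separated_at m by apply: (allP separated_small); rewrite mem_iota.
rewrite /separated_at; cbv zeta => /allP/(_ ((u, v), (point m u, point m v))).
rewrite mem_filter hv  (map_f (fun e => (e, (point m e.1, point m e.2)))) //.
move=> /(_ isT); cbv beta => /allP/(_ ((x, y), (point m x, point m y))).
rewrite mem_filter xlow (map_f (fun e => (e, (point m e.1, point m e.2)))) //.
move=> /(_ isT);
by rewrite /= ltnNge yv (negbTE nyv) (negbTE nyu) (negbTE nxu).
Qed.

(* The stronger conclusion for distant edges is what the induction needs when one
   edge is near the bottom and the other one near the top. *)
Lemma edges_separated_aux m x y u v :
  back m x y -> back m u v -> y <= v -> y != v -> y != u -> x != u ->
  if y + 24 <= u then far_separated (point m x) (point m y) (point m u) (point m v)
  else separated (point m x) (point m y) (point m u) (point m v).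
Proof.
have small k x' y' u' v' : k < 6 ->
    back k x' y' -> back k u' v' -> y' <= v' -> y' != v' -> y' != u' -> x' != u' ->
    x' < 74 -> 24 * k <= v' ->
    if y' + 24 <= u'
    then far_separated (point k x') (point k y') (point k u') (point k v')
    else separated (point k x') (point k y') (point k u') (point k v').
  move=> k6 xy uv h1 h2 h3 h4 h5 h6.
  have := edges_separated_small k6 xy uv h1 h2 h3 h4 h5 h6.
  rewrite /separation_test; case: ifP => _; first by move=> h; eexists; exact: h.
  by case/hasP=> a _ h; exists a.
elim: m x y u v => [|m IH] x y u v xy uv yv nyv nyu nxu.
  have := back_bound xy; have := back_bound uv.
  have := back_size uv => *.
  by apply: small => //; lia.
have [bxy buv] := (back_bound xy, back_bound uv).
have [vlow|vhigh] := ltnP v (27 + 24 * m).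
  have ylow : y < 27 + 24 * m by lia.
  have xlow : x < 27 + 24 * m by lia.
  have ulow : u < 27 + 24 * m by lia.
  rewrite !point_low //.
  rewrite back_low // in xy; rewrite back_low // in uv.
  exact: IH.
have [/andP[xhigh uhigh]|low] := boolP ((51 <= x) && (51 <= u)).
  have yhigh : 51 <= y by lia.
  have vhigh' : 51 <= v by lia.
  rewrite back_shift // in xy; rewrite back_shift // in uv.
  have := IH _ _ _ _ xy uv; rewrite !point_shift //.
  have -> : (y - 24 + 24 <= u - 24) = (y + 24 <= u) by lia.
  case: ifP => _ h; [apply: far_separated_scale | apply: separated_scale].
    by apply: h; lia.
  by apply: h; lia.
have [m5|m5] := ltnP m 5; first by apply: small => //; lia.
(* Here [v >= 147], so [u >= 124], hence [x < 51] and [y <= 73]. Even after the outer edge is pulled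
   in by one layer the gap is at least 24; so the inner edge stays, and the outer one is treated in
   the shorter tube and then dilated. *)
have far : y + 24 <= u by lia.
have far' : y + 24 <= u - 24 by lia.
have uhigh : 51 <= u by lia.
have vhigh' : 51 <= v by lia.
have ylow : y < 27 + 24 * m by lia.
have xlow' : x < 27 + 24 * m by lia.
rewrite back_low // in xy; rewrite back_shift // in uv.
rewrite far (point_shift m uhigh) (point_shift m vhigh') !point_low //.
apply: far_separated_away.
by have := IH _ _ _ _ xy uv; rewrite far'; apply; lia.
Qed.

Lemma edges_separated m x y u v : back m x y -> back m u v ->
  x != u -> x != v -> y != u -> y != v ->
  separated (point m x) (point m y) (point m u) (point m v).
Proof.
move=> xy uv nxu nxv nyu nyv; case/orP: (leq_total y v) => h.
  have := edges_separated_aux xy uv h nyv nyu nxu.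
  by case: ifP => // _; apply: far_separatedW.
apply: separatedC; rewrite eq_sym in nyv; rewrite eq_sym in nxv.
rewrite eq_sym in nxu.
have := edges_separated_aux uv xy h nyv nxv nxu.
by case: ifP => // _; apply: far_separatedW.
Qed.

Lemma separated_swapl p q u v : separated p q u v -> separated q p u v.
Proof. by case=> a /and4P[*]; exists a; apply/and4P; split. Qed.

Lemma adj_separated m x y u v : adj m x y -> adj m u v ->
  x != u -> x != v -> y != u -> y != v ->
  separated (point m x) (point m y) (point m u) (point m v).
Proof.
have aux x' y' : back m x' y' -> adj m u v ->
    x' != u -> x' != v -> y' != u -> y' != v ->
    separated (point m x') (point m y') (point m u) (point m v).
  move=> xy; case/orP=> uv nxu nxv nyu nyv; first exact: edges_separated.
  by apply/separatedC/separated_swapl/separatedC/edges_separated.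
move=> /orP[] xy uv nxu nxv nyu nyv; first exact: aux.
exact/separated_swapl/aux.
Qed.

(** The labels involved differ by at most 46. For [m >= 4], if one of them is at least 27 + 24 * m,
    then all are at least 77 and shift down together. *)
Lemma adj_transverse m x y v : adj m x y -> adj m x v ->
  transverse (y == v) (point m x) (point m y) (point m v).
Proof.
elim: m x y v => [|m IH] x y v xy xv; first exact: transverse_smallP.
have [m4|m4] := ltnP m 4; first exact: transverse_smallP.
have bxy := adj_bound xy; have bxv := adj_bound xv.
have [/and3P[hx hy hv]|hi] :=
    boolP [&& x < 27 + 24 * m, y < 27 + 24 * m & v < 27 + 24 * m].
  by rewrite !point_low //; rewrite !adj_low // in xy xv; apply: IH.
have hx : 51 <= x by lia.
have hy : 51 <= y by lia.
have hv : 51 <= v by lia.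
rewrite !adj_shift // in xy xv; rewrite !point_shift //.
apply: transverse_scale; have -> : (y == v) = (y - 24 == v - 24) by lia.
exact: IH.
Qed.

Lemma adj_point_neq m x y : adj m x y -> point m x <> point m y.
Proof. by move=> xy; apply/eqP; have := adj_transverse xy xy; rewrite eqxx. Qed.

Lemma adj_cross_neq0 m x y v : adj m x y -> adj m x v -> y != v ->
  cross (point m x) (point m y) (point m v) <> 0%Z.
Proof.
by move=> xy xv nyv; apply/eqP; have := adj_transverse xy xv; rewrite (negbTE nyv).
Qed.

(** * The drawing *)

Section Segments.
Local Notation R := Rdefinitions.R.
Local Notation IZR := Rdefinitions.IZR.
Local Open Scope ring_scope.

Definition real_point (p : Z * Z) : R * R := (IZR p.1, IZR p.2).

Definition segment (p q : Z * Z) (t : R) : R * R :=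
  (IZR p.1 + t * (IZR q.1 - IZR p.1), IZR p.2 + t * (IZR q.2 - IZR p.2)).

Lemma IZR_D a b : IZR (a + b)%Z = IZR a + IZR b.
Proof. exact: RIneq.plus_IZR. Qed.

Lemma IZR_B a b : IZR (a - b)%Z = IZR a - IZR b.
Proof. exact: RIneq.minus_IZR. Qed.

Lemma IZR_M a b : IZR (a * b)%Z = IZR a * IZR b.
Proof. exact: RIneq.mult_IZR. Qed.

Lemma IZR_ltr a b : (a <? b)%Z -> IZR a < IZR b.
Proof. by move=> h; apply/RltP/RIneq.IZR_lt; lia. Qed.

Lemma segment0 p q : segment p q 0 = real_point p.
Proof. by rewrite /segment !mul0r !addr0. Qed.

Lemma segment1 p q : segment p q 1 = real_point q.
Proof. by rewrite /segment !mul1r !subrKC. Qed.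

Lemma segment_rev p q t : segment p q t = segment q p (1 - t).
Proof. by rewrite /segment; congr pair; ring. Qed.

Lemma affine_continuous (K : realType) (a b : K) :
  continuous (fun x : K => a + x * b).
Proof.
move=> t; apply: (@continuousD K K K (fun=> a) (fun x => x * b)).
  exact: cst_continuous.
by apply: (@continuousM K K id (fun=> b)); [exact: cvg_id | exact: cst_continuous].
Qed.

Lemma segment_continuous p q : {within `[0, 1], continuous (segment p q)}%classic.
Proof.
apply: continuous_subspaceT => t.
exact: (cvg_pair (@affine_continuous R _ _ t) (@affine_continuous R _ _ t)).
Qed.

Lemma real_point_inj : injective real_point.
Proof. by move=> [a b] [c d] [/RIneq.eq_IZR -> /RIneq.eq_IZR ->]. Qed.

Lemma segment_inj p q : p <> q -> injective (segment p q).
Proof.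
move=> pq s t [e1 e2]; apply/eqP; rewrite -subr_eq0; apply/negP => /negP st.
have same (a b : R) : a + s * (b - a) = a + t * (b - a) -> a = b.
  move=> e; have /eqP : (s - t) * (b - a) = 0 by lra.
  by rewrite mulf_eq0 (negbTE st) subr_eq0 => /eqP.
by apply/pq/real_point_inj; rewrite /real_point (same _ _ e1) (same _ _ e2).
Qed.

Lemma between_gt (c u v t : R) : c < u -> c < v -> 0 <= t <= 1 ->
  c < u + t * (v - u).
Proof.
move=> cu cv /andP[t0 t1]; have [uv|vu] := lerP u v.
  have : 0 <= t * (v - u) by apply: mulr_ge0 => //; lra.
  lra.
have : 0 <= (1 - t) * (u - v) by apply: mulr_ge0; lra.
lra.
Qed.

Lemma between_lt (c u v t : R) : u < c -> v < c -> 0 <= t <= 1 ->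
  u + t * (v - u) < c.
Proof.
move=> uc vc t01; have := @between_gt (- c) (- u) (- v) t.
by rewrite !ltrN2 => /(_ uc vc t01); lra.
Qed.

(** On the first segment the functional stays below its values at [u] and [v], hence below all its
    values on the second segment. *)
Lemma separated_segments p q u v s t : separated p q u v ->
  0 <= s <= 1 -> 0 <= t <= 1 -> segment p q s <> segment u v t.
Proof.
case=> a /and4P[pu pv qu qv] s01 t01 [e1 e2].
have val x : IZR (dot a x) = IZR a.1 * IZR x.1 + IZR a.2 * IZR x.2.
  by rewrite /dot IZR_D !IZR_M.
have := between_gt (between_lt (IZR_ltr pu) (IZR_ltr qu) s01)
  (between_lt (IZR_ltr pv) (IZR_ltr qv) s01) t01.
rewrite !val; apply/negP; rewrite -leNgt le_eqVlt; apply/orP; left.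
rewrite eq_sym; apply/eqP.
transitivity (IZR a.1 * (IZR p.1 + s * (IZR q.1 - IZR p.1)) +
              IZR a.2 * (IZR p.2 + s * (IZR q.2 - IZR p.2))); first by ring.
by rewrite e1 e2; ring.
Qed.

(** Eliminating [t] from the two coordinate equations leaves [s * cross o p q = 0]. *)
Lemma transverse_segments o p q s t : cross o p q <> 0%Z ->
  segment o p s = segment o q t -> s = 0.
Proof.
move=> pq [e1 e2].
have {}e1 : s * (IZR p.1 - IZR o.1) = t * (IZR q.1 - IZR o.1) by lra.
have {}e2 : s * (IZR p.2 - IZR o.2) = t * (IZR q.2 - IZR o.2) by lra.
have : s * IZR (cross o p q) = 0.
  rewrite /cross IZR_B !IZR_M !IZR_B mulrBr !mulrA e1 e2; ring.
move/eqP; rewrite mulf_eq0 => /orP[/eqP //|/eqP h]; case: pq.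
exact: (@RIneq.eq_IZR _ 0%Z).
Qed.

Lemma star_segments m x y v s t : adj m x y -> adj m x v -> y != v ->
  segment (point m x) (point m y) s = segment (point m x) (point m v) t -> s = 0.
Proof. by move=> xy xv yv; apply/transverse_segments/adj_cross_neq0. Qed.

(** An edge from [z] to some [w] turns the incidence into a meeting of two edges: they are separated
    if disjoint, and transverse if [w] is [x] or [y]. *)
Lemma vertex_on_segment m x y z t : adj m x y -> (z < 50 + 24 * m)%nat ->
  0 <= t <= 1 -> segment (point m x) (point m y) t = real_point (point m z) ->
  z = x \/ z = y.
Proof.
move=> xy hz t01 e; have [->|zx] := eqVneq z x; first by left.
have [->|zy] := eqVneq z y; first by right.
have [w zw] := exists_adj hz; have wz := zw; rewrite adjC in wz.
have yx := xy; rewrite adjC in yx.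
have [wx|wx] := eqVneq w x.
  subst w; move: e; rewrite -(segment1 (point m x)) => /esym.
  by move/(star_segments wz xy zy)/eqP; rewrite oner_eq0.
have [wy|wy] := eqVneq w y.
  subst w; move: e; rewrite segment_rev -(segment1 (point m y)) => /esym.
  by move/(star_segments wz yx zx)/eqP; rewrite oner_eq0.
have sep : separated (point m x) (point m y) (point m z) (point m w).
  by apply: adj_separated => //; rewrite eq_sym.
by case: (separated_segments sep t01 (t := 0)); rewrite ?lexx ?ler01 ?segment0.
Qed.

(** A coincidence would put [y] at parameter 0 of an edge from [x] to some [w], so [y] is [x] or
    [w], and the ends of an edge have distinct points. *)
Lemma point_inj m x y : (x < 50 + 24 * m)%nat -> (y < 50 + 24 * m)%nat ->
  point m x = point m y -> x = y.
Proof.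
move=> hx hy e; have [w xw] := exists_adj hx.
have : segment (point m x) (point m w) 0 = real_point (point m y).
  by rewrite segment0 e.
case/(vertex_on_segment xw hy); rewrite ?lexx ?ler01 // => yw.
by case: (adj_point_neq xw); rewrite e yw.
Qed.

Lemma edge_interiors_disjoint m x y u v s t : adj m x y -> adj m u v ->
  ~ (x = u /\ y = v) -> ~ (x = v /\ y = u) -> 0 < s < 1 -> 0 < t < 1 ->
  segment (point m x) (point m y) s <> segment (point m u) (point m v) t.
Proof.
move=> xy uv n1 n2 hs ht e.
have yx := xy; rewrite adjC in yx; have vu := uv; rewrite adjC in vu.
have s0 : s <> 0 by lra.
have s1 : 1 - s <> 0 by lra.
(* A shared end is made the start of both segments; transversality then forces an interior parameter
   to be 0. *)
have [xu|xu] := eqVneq x u.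
  subst u; apply/s0/(star_segments xy uv _ e); apply/eqP => yv; exact: n1.
have [xv|xv] := eqVneq x v.
  subst v; rewrite (segment_rev (point m u)) in e.
  apply/s0/(star_segments xy vu _ e); apply/eqP => yu; exact: n2.
have [yu|yu] := eqVneq y u.
  subst u; rewrite segment_rev in e.
  exact/s1/(star_segments yx uv xv e).
have [yv|yv] := eqVneq y v.
  subst v; rewrite segment_rev (segment_rev (point m u)) in e.
  exact/s1/(star_segments yx vu xu e).
have sep := adj_separated xy uv xu xv yu yv.
by apply: (separated_segments sep _ _ e); lra.
Qed.

Lemma adj_planar m (e : rel 'I_(50 + 24 * m)) :
  (forall x y, e x y = adj m x y) -> planar e.
Proof.
move=> eE; exists (fun x : 'I__ => real_point (point m x)).
exists (fun x y : 'I__ => segment (point m x) (point m y)); split; last split.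
- by move=> x y /real_point_inj/point_inj h; apply/val_inj/h.
- move=> x y; rewrite eE => xy.
  have inj := segment_inj (adj_point_neq xy).
  split; first exact: segment_continuous.
  split; first exact: segment0.
  split; first exact: segment1.
  split; first by move=> s t _ _; apply: inj.
  move=> t z t01 tz.
  have t01' : 0 <= t <= 1 by lra.
  case: (vertex_on_segment xy (ltn_ord z) t01' tz) => zE; move: tz; rewrite zE.
    by rewrite -(segment0 _ (point m y)) => /inj; lra.
  by rewrite -(segment1 (point m x)) => /inj; lra.
- move=> x y u v; rewrite !eE => xy uv neq s t hs ht.
  apply: edge_interiors_disjoint => // -[/val_inj h1 /val_inj h2];
    by move: neq; rewrite h1 h2 ?eqxx // finset.setUC eqxx.
Qed.

End Segments.

Theorem theorem4 (n : nat) :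
  0 < n -> n = 50 %[mod 288] ->
  exists e : rel 'I_n,
    simple_graph e /\ planar e /\
    ~ contains_subgraph K4 e /\ ~ contains_subgraph C6 e /\
    3 * #|edges e| = 7 * (n - 2).
Proof.
(* As 288 = 24 * 12, each further 288 vertices amount to 12 layers. *)
move=> _ hn; have {hn} -> : n = 50 + 24 * (12 * (n %/ 288)).
  by rewrite {1}(divn_eq n 288) hn; lia.
set m := 12 * _; pose e : rel 'I_(50 + 24 * m) := fun x y => adj m x y.
have eE x y : e x y = adj m x y by [].
exists e; split; first by split=> [x y|x]; rewrite !eE ?adjxx // adjC.
split; first exact: adj_planar.
split; first by move/(embeds_of_subgraph eE (@K4_window m)); apply: K4_not_embeds.
split; first by move/(embeds_of_subgraph eE (@C6_window m)); apply: C6_not_embeds.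
(* Both sides equal 336 + 168 * m. *)
by rewrite (card_edges eE); lia.
Qed.
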